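(* Let $p$ be a prime and let $G$ be a finite group that is not $p$-closed. Then $$\chi_p(G)\equiv 1 \pmod{p^d},$$ where $p^d=\min\{|P:P\cap Q| \mid P,Q\in\mathrm{Syl}_p(G),\ P\neq Q\}$.
   Context: $\mathrm{Syl}_p(G)$ is the set of Sylow $p$-subgroups of $G$. $G$ is $p$-closed if it has a normal Sylow $p$-subgroup. $\mathscr{C}_p(G)$ is the poset, ordered by inclusion, of all right cosets $Hx$ ($x\in G$) of $p$-subgroups $H$ of $G$ (including the trivial subgroup). For a finite poset $\mathcal{P}$, $\chi(\mathcal{P})=\sum_{i\ge 0}(-1)^i\#\{\text{chains of } i+1 \text{ elements in }\mathcal{P}\}$ is the (non-reduced) Euler characteristic of its order complex. $|G|_{p'}$ is the largest positive divisor of $|G|$ coprime to $p$, and $\chi_p(G):=\chi(\mathscr{C}_p(G))/|G|_{p'}$, which is an integer. *)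

(* Defs.v *)
From HB Require Import structures.
From mathcomp Require Import all_boot all_order all_algebra.
From mathcomp Require Import all_fingroup all_solvable.

Set Implicit Arguments.
Unset Strict Implicit.
Unset Printing Implicit Defensive.

Import Order.TTheory GRing.Theory Num.Theory.
(* Orders every [{set T}] by inclusion. *)
Import Order.DefaultSetSubsetOrder.

Local Open Scope group_scope.

Section EulerCharacteristic.

Context {d : Order.disp_t} {T : finPOrderType d}.
Implicit Types (S : {set T}) (i : nat).

(* Chains are counted as subsets, so [chains S i] are the [i]-dimensional      *)
(* simplices of the order complex of the subposet [S].                        *)
Definition chains S i : {set {set T}} :=
  [set K : {set T} | [&& K \subset S,
                         [forall x in K, forall y in K, (x >=< y)%O]
                       & #|K| == i.+1]].

(* Non-reduced; a chain in [S] has at most [#|S|] elements, which bounds [i]. *)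
Definition euler_char S : int :=
  (\sum_(i < #|S|) (-1) ^+ i * #|chains S i|%:Z)%R.

End EulerCharacteristic.

Section CosetPoset.

Variable gT : finGroupType.
Implicit Types (p : nat) (G H : {group gT}).

Definition pcosets p G : {set {set gT}} :=
  \bigcup_(H : {group gT} | psubgroup p G H) rcosets H G.

(* The division is exact, see [dvd_euler_char_pcosets]. *)
Definition chi_p p G : int :=
  (euler_char (pcosets p G) %/ (#|G|`_p^')%:Z)%Z.

Definition p_closed p G : bool :=
  [exists P : {group gT} in 'Syl_p(G), P <| G].

Definition is_min_Syl_index p G (m : nat) : Prop :=
  (exists P Q : {group gT}, [/\ P \in 'Syl_p(G), Q \in 'Syl_p(G), P != Q
                              & #|P : P :&: Q| = m])
  /\ (forall P Q : {group gT}, P \in 'Syl_p(G) -> Q \in 'Syl_p(G) -> P != Q ->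
        m <= #|P : P :&: Q|).

Lemma pcosetsP p G (A : {set gT}) :
  reflect (exists2 H : {group gT}, psubgroup p G H
             & exists2 x, x \in G & A = H :* x)
          (A \in pcosets p G).
Proof.
apply: (iffP bigcupP) => [[H pH /rcosetsP[x Gx ->]]|[H pH [x Gx ->]]].
  by exists H => //; exists x.
by exists H => //; apply/rcosetsP; exists x.
Qed.

Lemma chain_stab_pgroup p G i (K : {set {set gT}}) :
  K \in chains (pcosets p G) i -> p.-group 'C_G[K | 'Rs^*].
Proof.
rewrite inE => /and3P[/subsetP sK /'forall_in_'forall_in_idP cK /eqP cardK].
have [A KA] : exists A, A \in K by apply/card_gt0P; rewrite cardK.
have /pcosetsP[H /andP[_ pH] [x _ defA]] := sK A KA.
suff sS : 'C_G[K | 'Rs^*] \subset H :^ x by apply: pgroupS sS _; rewrite pgroupJ.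
apply/subsetP=> a /setIP[_ /astab1P fixK].
have KAa : A :* a \in K.
  by rewrite -fixK -rcosetE; apply: imset_f.
have eqA : A :* a = A.
  have := cK _ KAa _ KA; rewrite /Order.comparable /= => /orP[] le_A; apply/eqP.
    by rewrite eqEcard card_rcoset leqnn andbT.
  by rewrite eq_sym eqEcard card_rcoset leqnn andbT.
move: eqA; rewrite defA => eqA.
have : x * a \in H :* x by rewrite -eqA mem_rcoset mulgK rcoset_refl.
by rewrite mem_rcoset mem_conjg conjgE invgK mulgA.
Qed.

Lemma acts_chains p G i : [acts G, on chains (pcosets p G) i | 'Rs^*].
Proof.
have imP (K : {set {set gT}}) a : a \in G -> K \in chains (pcosets p G) i ->
    ('Rs^*)%act K a \in chains (pcosets p G) i.
  move=> Ga; rewrite !inE => /and3P[/subsetP sK /'forall_in_'forall_in_idP cK cardK].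
  apply/and3P; split; last by rewrite card_setact.
    apply/subsetP=> _ /imsetP[A /sK/pcosetsP[H pH [x Gx ->]] ->].
    apply/pcosetsP; exists H => //; exists (x * a); first exact: groupM.
    by rewrite /= rcosetE rcosetM.
  apply/'forall_in_'forall_in_idP=> _ /imsetP[A KA ->] _ /imsetP[B KB ->].
  have := cK A KA B KB; rewrite /Order.comparable /= !rcosetE.
  by case/orP=> sAB; apply/orP; [left | right]; apply: mulSg.
apply/subsetP=> a Ga; rewrite !inE /=; apply/subsetP=> K cK; rewrite inE.
exact: imP.
Qed.

Lemma dvd_card_chains p G i : #|G|`_p^' %| #|chains (pcosets p G) i|.
Proof.
rewrite -(acts_sum_card_orbit (acts_chains p G i)).
apply: dvdn_sum => _ /imsetP[K cK ->]; rewrite card_orbit_in ?subsetT //.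
have pS := chain_stab_pgroup cK.
have co : coprime #|G|`_p^' #|'C_G[K | 'Rs^*]|.
  by rewrite coprime_sym; apply: pnat_coprime pS (part_pnat _ _).
by rewrite -(Gauss_dvdr _ co) Lagrange ?subsetIl ?dvdn_part.
Qed.

Lemma dvd_euler_char_pcosets p G :
  ((#|G|`_p^')%:Z %| euler_char (pcosets p G))%Z.
Proof.
apply: rpred_sum => j _; apply: dvdz_mull.
exact: dvd_card_chains.
Qed.

End CosetPoset.

(* Main.v *)
Require Import Defs.
From mathcomp Require Import all_boot all_order all_algebra.
From mathcomp Require Import all_fingroup all_solvable.
From mathcomp Require Import ring.

(** Say that [f] is a coweight on a finite poset [S] when, for each [x] in [S],
    the values of [f] over the elements of [S] above [x] sum to 1. Removing a
    minimal element shows that a coweight exists and that its total sum is the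
    Euler characteristic ([coweight_exists], [euler_char_coweight]).

    Take a coweight [f] on the poset of p-subgroups of [G]. Above a coset [Hx]
    of a p-subgroup lie exactly the cosets [Kx] with [K] a p-subgroup
    containing [H], so [Hx |-> f H] is a coweight on the coset poset
    ([coweight_pcosets]). Since [H] has [#|G : H|] cosets, dividing the total
    by the p'-part of [#|G|] gives ([chi_pE])
      [chi_p p G = \sum_H f H * (#|G|`_p / #|H|)].

    This sum is read modulo [m], where [m] divides every [#|P : P :&: Q|] with
    [P] and [Q] distinct Sylow p-subgroups. If [H] lies in two distinct Sylow
    subgroups [P] and [Q], then [#|G|`_p / #|H| = #|P : H|] is a multiple of
    [#|P : P :&: Q|], hence of [m]. If [H] lies in a single Sylow subgroup [P],
    downward induction on [H] gives [f H = 1] when [H = P] and [f H = 0]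
    otherwise ([coweight_unique_Sylow]). Hence [chi_p p G] is congruent to the
    number of Sylow p-subgroups. That number is 1 modulo [m]: in the conjugation
    action of [P] on the Sylow subgroups other than [P], the orbit of [Q] has
    [#|P : P :&: Q|] elements ([card_Syl_mod]).

    When [G] is not p-closed there are at least two Sylow p-subgroups, and the
    indices [#|P : P :&: Q|] are powers of [p], so the least of them divides all
    the others and may serve as [m]. *)

(** * Euler characteristics and coweights *)

Section Poset.

Set Implicit Arguments.
Unset Strict Implicit.
Import Order.TTheory GRing.Theory.
Local Open Scope ring_scope.

Context {d : Order.disp_t} {T : finPOrderType d}.
Implicit Types (S U K : {set T}) (m x : T) (f : T -> int).

Definition is_chain K : bool := [forall x in K, forall y in K, (x >=< y)%O].

(** The opposite of the reduced Euler characteristic: here the empty chain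
    counts, which is what makes removing an element a clean recursion. *)
Definition signed_chains S : int :=
  \sum_(K : {set T} | (K \subset S) && is_chain K) (-1) ^+ #|K|.

Lemma is_chainP K : reflect {in K &, forall x y, (x >=< y)%O} (is_chain K).
Proof.
apply: (iffP 'forall_in_'forall_in_idP) => [cK x y Kx|cK x Kx y Ky].
  exact: cK.
exact: cK.
Qed.

Lemma euler_charE S : euler_char S = 1 - signed_chains S.
Proof.
rewrite /signed_chains.
(* The class of size 0, the empty chain alone, provides the 1. *)
rewrite (partition_big (fun K => inord #|K| : 'I_(#|S|.+1)) predT) //=.
rewrite big_ord_recl /= opprD addrA.
have szP K : K \subset S -> (inord #|K| : 'I_(#|S|.+1)) = #|K| :> nat.
  by move=> sK; rewrite inordK // ltnS subset_leq_card.
rewrite (big_pred1 set0) => [|K]; last first.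
  apply/andP/eqP => [[/andP[/szP eqK _] /eqP K0]|->].
    by apply/eqP; rewrite -cards_eq0 -eqK K0.
  rewrite sub0set cards0; split; last by apply/eqP/val_inj; rewrite /= inordK.
  by apply/is_chainP=> x y; rewrite inE.
rewrite cards0 expr0 subrr add0r.
rewrite /euler_char -sumrN; apply: eq_bigr => i _.
rewrite -[_%:Z]intz -pmulrn -sumr_const big_distrr -sumrN /=.
have chainsE K :
    ((K \subset S) && is_chain K && (inord #|K|
      == lift ord0 i :> 'I_(#|S|.+1)))
   = (K \in chains S i).
  rewrite inE andbA; case sK: (K \subset S) => //=; congr (_ && _).
  by rewrite -val_eqE /= szP.
rewrite (eq_bigl _ _ chainsE); apply: eq_bigr => K.
by rewrite inE => /and3P[_ _ /eqP ->]; rewrite exprS mulN1r opprK mulr1.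
Qed.

Definition minimal_in S m := (m \in S) && [forall x in S, ~~ (x < m)%O].

(** As [m] is minimal, deleting it from the chains that contain it is a
    sign-reversing bijection onto all the chains strictly above [m], the empty
    one included. *)
Lemma signed_chains_rem S m : minimal_in S m ->
  signed_chains S
    = signed_chains (S :\ m) - signed_chains [set x in S | (m < x)%O].
Proof.
case/andP=> Sm /'forall_in_idP minm.
rewrite /signed_chains (bigID (fun K : {set T} => m \in K)) /= addrC; congr (_ + _).
  by apply: eq_bigl => K; rewrite subsetD1 andbAC.
rewrite (reindex_onto (fun K => m |: K) (fun K => K :\ m)) /=; last first.
  by move=> K /andP[_ /setD1K].
rewrite -sumrN; apply: eq_big => [K|K /andP[_ /eqP <-]]; last first.
  by rewrite cardsU1 setD11 /= exprS mulN1r.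
have [Km|nKm] /= := boolP (m \in K).
  rewrite [RHS]andbC (_ : K \subset _ = false) ?andbF; last first.
    by apply/subsetP=> /(_ m Km); rewrite inE ltxx andbF.
  apply/negP=> /andP[_ /eqP eqK].
  by move: Km; rewrite -eqK setD11.
rewrite setU1K // eqxx andbT setU11 andbT subUset sub1set Sm /=.
apply/andP/andP=> [][sK /is_chainP cK]; split.
- apply/subsetP=> x Kx; have Sx := subsetP sK x Kx.
  rewrite inE Sx /= lt_neqAle; apply/andP; split.
    by apply: contra nKm => /eqP->.
  have := cK m x (setU11 _ _) (setU1r _ Kx).
  rewrite /Order.comparable [(x <= m)%O]le_eqVlt (negPf (minm x Sx)) orbF.
  by case/orP=> [|/eqP->].
- by apply/is_chainP=> x y Kx Ky; apply: cK; rewrite setU1r.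
- by apply: subset_trans sK _; apply/subsetP=> x; rewrite inE => /andP[].
have ltm x : x \in K -> (m <= x)%O.
  by move=> /(subsetP sK); rewrite inE => /andP[_ /ltW].
apply/is_chainP=> x y /setU1P[->|Kx] /setU1P[->|Ky]; rewrite ?comparablexx //.
- by rewrite /Order.comparable ltm.
- by rewrite /Order.comparable ltm ?orbT.
- exact: cK.
Qed.

Lemma minimal_exists S x : x \in S -> exists m, minimal_in S m.
Proof.
move=> Sx; pose below y := [set z in S | (z < y)%O].
case: (arg_minnP (fun y => #|below y|) Sx) => m Sm minm.
exists m; apply/andP; split=> //; apply/'forall_in_idP=> y Sy.
apply/negP=> lt_ym; have := minm y Sy; rewrite leqNgt => /negP[].
apply/proper_card/properP; split.
  by apply/subsetP=> z; rewrite !inE => /andP[-> /lt_trans->].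
by exists y; rewrite !inE ?Sy ?lt_ym // ltxx andbF.
Qed.

(** This is [x |-> - mu x oo], for the Moebius function [mu] of [S] with a
    greatest element [oo] added. *)
Definition coweight S f := forall x, x \in S -> \sum_(y in S | (x <= y)%O) f y = 1.

Lemma coweight_up S U f : U \subset S ->
    {in U & S, forall x y, (x <= y)%O -> y \in U} ->
  coweight S f -> coweight U f.
Proof.
move=> sUS upU cwf x Ux; rewrite -(cwf x (subsetP sUS x Ux)).
apply: eq_bigl => y; apply/andP/andP=> [][yS lexy]; split=> //.
  exact: (subsetP sUS).
exact: upU yS lexy.
Qed.

Lemma minimal_rem_up S m : minimal_in S m ->
  {in S :\ m & S, forall x y, (x <= y)%O -> y \in S :\ m}.
Proof.
case/andP=> _ /'forall_in_idP minm x y; rewrite !inE => /andP[nxm Sx] Sy lexy.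
rewrite Sy andbT; apply: contraNneq (minm x Sx) => eqym.
move: nxm lexy; rewrite eqym => nxm lexm.
by rewrite lt_neqAle nxm lexm.
Qed.

(** Removing a minimal [m] changes the Euler characteristic by 1 minus that of
    the part of [S] strictly above [m]. By induction the latter is the sum of
    [f] over that part, which the equation at [m] gives as [1 - f m]. So the
    change is [f m]. *)
Lemma euler_char_coweight S f :
  coweight S f -> euler_char S = \sum_(x in S) f x.
Proof.
have [n leSn] := ubnP #|S|; elim: n => // n IHn in S leSn *.
have [->|[x Sx] cwf] := set_0Vmem S.
  by rewrite big_set0 /euler_char big_pred0 // => -[i]; rewrite cards0.
have [m minm] := minimal_exists Sx; have [Sm _] := andP minm.
have leS1 : (#|S :\ m| < n)%N by move: leSn; rewrite (cardsD1 m) Sm ltnS.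
have sSm : [set y in S | (m < y)%O] \subset S :\ m.
  by apply/subsetP=> y; rewrite !inE => /andP[-> /gt_eqF->].
have sS1 : S :\ m \subset S by apply: subsetDl.
have chiS1 := IHn _ leS1 (coweight_up sS1 (minimal_rem_up minm) cwf).
have chiSm : euler_char [set y in S | (m < y)%O] = \sum_(y in S | (m < y)%O) f y.
  rewrite IHn ?(leq_ltn_trans (subset_leq_card sSm)) //.
    by apply: eq_bigl => y; rewrite inE.
  apply: coweight_up cwf; first exact: subset_trans sSm sS1.
  by move=> y z; rewrite !inE => /andP[_ ltmy] -> /(lt_le_trans ltmy)->.
have fm : f m + \sum_(y in S | (m < y)%O) f y = 1.
  rewrite -[RHS](cwf m Sm) [RHS](bigD1 m) ?Sm ?lexx //=; congr (_ + _).
  by apply: eq_bigl => y; rewrite -andbA [(m <= y)%O && _]andbC -lt_def.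
rewrite (big_setD1 m Sm) /= -chiS1 (canRL (addrK _) fm) -chiSm.
rewrite !euler_charE (signed_chains_rem minm).
set a := signed_chains (S :\ m); set b := signed_chains _; ring.
Qed.

(** The equation at a minimal [m] is the only one that involves [f m], so it
    can be solved for [f m] once the rest of [S] is done. *)
Lemma coweight_exists S : exists f, coweight S f.
Proof.
have [n leSn] := ubnP #|S|; elim: n => // n IHn in S leSn *.
have [->|[x Sx]] := set_0Vmem S; first by exists (fun=> 0) => x; rewrite inE.
have [m minm] := minimal_exists Sx; have [Sm _] := andP minm.
have [|f cwf] := IHn (S :\ m); first by move: leSn; rewrite (cardsD1 m) Sm ltnS.
exists (fun y =>
  if y == m then 1 - \sum_(z in S :\ m | (m <= z)%O) f z else f y).
have sumD1 (z : T) :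
    \sum_(y in S :\ m | (z <= y)%O)
       (if y == m then 1 - \sum_(z in S :\ m | (m <= z)%O) f z else f y)
      = \sum_(y in S :\ m | (z <= y)%O) f y.
  by apply: eq_bigr => y; rewrite !inE => /andP[/andP[/negPf->]].
move=> y Sy; have [->|nym] := eqVneq y m.
  rewrite (bigD1 m) ?Sm ?lexx //= eqxx.
  under [X in _ + X]eq_bigl => z.
    rewrite (_ : _ && _ = (z \in S :\ m) && (m <= z)%O); first over.
    by rewrite !inE andbAC [_ && (z != m)]andbC.
  by rewrite sumD1 subrK.
have S1y : y \in S :\ m by rewrite !inE nym.
rewrite -[RHS](cwf y S1y) -[RHS]sumD1; apply: eq_bigl => z.
apply/andP/andP=> [] [Sz leyz]; split=> //.
  exact: minimal_rem_up S1y Sz leyz.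
by case/setD1P: Sz.
Qed.

End Poset.

(** * The poset of cosets of p-subgroups *)

Section CosetPoset.

Set Implicit Arguments.
Unset Strict Implicit.
Import GRing.Theory Order.DefaultSetSubsetOrder.
Local Open Scope group_scope.

Variables (gT : finGroupType) (p : nat).
Implicit Types (G H K P Q : {group gT}) (A B : {set gT}) (f : {set gT} -> int).

Definition psubgroups G : {set {set gT}} :=
  [set A : {set gT} | group_set A && psubgroup p G A].

Lemma le_setE A B : (A <= B)%O = (A \subset B).
Proof. by []. Qed.

Lemma psubgroupsP G A :
  reflect (exists2 H : {group gT}, psubgroup p G H & A = H) (A \in psubgroups G).
Proof.
rewrite inE; apply: (iffP andP) => [[gA pA]|[H pH ->]]; first by exists (Group gA).
by rewrite groupP.
Qed.

(** So [A * A^-1] recovers [H] from a coset [A] of [H], without choosing a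
    representative. *)
Lemma mul_rcosetV H x : (H :* x) * (H :* x)^-1 = H.
Proof.
by rewrite invMg mulgA -(mulgA H) invg_set1 mulg_set1 mulgV mulg1 invGid mulGid.
Qed.

(** A coset of [K] containing [Hx] contains [x], so it is [Kx], and then
    [H \subset K]. Hence translation by [x] identifies the p-subgroups above
    [H] with the elements of the coset poset above [Hx]. *)
Lemma coweight_pcosets G f :
  coweight (psubgroups G) f -> coweight (pcosets p G) (fun A => f (A * A^-1)).
Proof.
move=> cwf _ /pcosetsP[H pH [x Gx ->]].
have S0H : gval H \in psubgroups G by apply/psubgroupsP; exists H.
rewrite -(cwf _ S0H) (reindex_onto (fun A => A :* x) (fun B => B * B^-1)) /=.
  apply: eq_big => [A|A /andP[_ /eqP ->] //]; apply/idP/idP.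
    case/andP=> /andP[/pcosetsP[K pK [y Gy eqAK]]].
    rewrite eqAK mul_rcosetV -eqAK => sHA /eqP defK; rewrite -defK in sHA *.
    apply/andP; split; first by apply/psubgroupsP; exists K.
    by rewrite le_setE -(rcosetS x).
  case/andP=> /psubgroupsP[K pK ->] sHK; rewrite mul_rcosetV eqxx andbT.
  apply/andP; split; last exact: mulSg.
  by apply/pcosetsP; exists K => //; exists x.
move=> _ /andP[/pcosetsP[K _ [y _ ->]] sHxKy].
rewrite mul_rcosetV; apply/rcoset_eqP.
exact: subsetP sHxKy _ (rcoset_refl _ _).
Qed.

Lemma sum_pcosets G f :
  (\sum_(A in pcosets p G) f (A * A^-1)%g
    = \sum_(H : {group gT} | psubgroup p G H) f H *+ #|G : H|)%R.
Proof.
(* [A * A^-1] is already a group; generating only equips it with that structure. *)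
rewrite (partition_big (fun A => <<A * A^-1>>%G) (fun H => psubgroup p G H)) /=.
  apply: eq_bigr => H pH; rewrite -sumr_const; apply: eq_big => [A|A].
    apply/andP/idP => [[/pcosetsP[K pK [x Gx ->]] /eqP <-]|/rcosetsP[x Gx ->]].
      by rewrite /= mul_rcosetV genGid; apply/rcosetsP; exists x.
    split; first by apply/pcosetsP; exists H => //; exists x.
    by apply/eqP/val_inj; rewrite /= mul_rcosetV genGid.
  case/andP=> /pcosetsP[K _ [x _ ->]] /eqP <-.
  by rewrite /= !mul_rcosetV genGid.
move=> _ /pcosetsP[K pK [x _ ->]].
by rewrite /= mul_rcosetV genGid.
Qed.

Lemma chi_pE G f : coweight (psubgroups G) f ->
  (chi_p p G
    = \sum_(H : {group gT} | psubgroup p G H) f H *+ (#|G|`_p %/ #|H|))%R.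
Proof.
move=> cwf; rewrite /chi_p (euler_char_coweight (coweight_pcosets cwf)).
rewrite sum_pcosets.
have idxE H : psubgroup p G H -> #|G : H| = (#|G|`_p %/ #|H| * #|G|`_p^')%N.
  case/andP=> sHG pH; rewrite -divgS // -{1}(partnC p (cardG_gt0 G)) divn_mulAC //.
  by rewrite -(part_pnat_id pH) partn_dvd ?cardSg.
under eq_bigr => H pH do rewrite idxE // mulrnA -mulr_natr.
by rewrite -big_distrl /= natz mulzK // -lt0n part_gt0.
Qed.

(** * Congruences modulo the intersection indices of Sylow subgroups *)

(** Downward induction on [H]: the p-subgroups [K] strictly above [H] also lie
    in [P] and in no other Sylow subgroup, so they contribute 1 in all if [P]
    is among them, that is, if [H != P], and 0 otherwise. The equation at [H]
    then leaves 0 or 1 for [f H]. *)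
Lemma coweight_unique_Sylow G f P H :
    coweight (psubgroups G) f -> p.-Sylow(G) P -> psubgroup p G H ->
    (forall Q, p.-Sylow(G) Q -> H \subset Q -> Q = P) ->
  f H = (H == P)%:R%R.
Proof.
move=> cwf sylP; have [n] := ubnP (#|G| - #|H|); elim: n => // n IHn in H *.
move=> leGn pH uniqP; have [sHG pgH] := andP pH.
have S0 K : psubgroup p G K -> gval K \in psubgroups G.
  by move=> pK; apply/psubgroupsP; exists K.
have sKP K : psubgroup p G K -> H \subset K -> K \subset P.
  case/andP=> sKG pK sHK; have [Q sylQ sKQ] := Sylow_superset sKG pK.
  by rewrite -(uniqP Q sylQ) // (subset_trans sHK).
have pP : psubgroup p G P.
  by apply/andP; split; [apply: pHall_sub sylP | apply: pHall_pgroup sylP].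
have fK A : [&& A \in psubgroups G, H \subset A & A != H] -> f A = (A == P)%:R%R.
  case/and3P=> /psubgroupsP[K pK ->] sHK neqKH; rewrite IHn //; last first.
    by move=> Q sylQ sKQ; apply: uniqP => //; apply: subset_trans sKQ.
  have ltHK : #|H| < #|K| by rewrite proper_card // properEneq eq_sym neqKH.
  have [sKG _] := andP pK; have leKG := subset_leq_card sKG.
  by rewrite -ltnS (leq_trans _ leGn) // ltnS ltn_sub2l // (leq_trans ltHK).
have := cwf _ (S0 _ pH); rewrite (bigD1 (gval H)) ?S0 ?Order.POrderTheory.lexx //=.
rewrite (eq_bigr (fun A : {set gT} => (A == P)%:R%R)); last first.
  by move=> A /andP[/andP[S0A sHA] nAH]; apply: fK; apply/and3P.
have [eqHP|nHP] := eqVneq H P.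
  rewrite big1 ?addr0 // => A /andP[/andP[/psubgroupsP[K pK ->] sHK] nKH].
  case: eqP => // eqKP; case/eqP: nKH.
  by rewrite eqKP eqHP.
have sHP : H \subset P by apply: sKP pH _.
have nPH : gval P != H by apply: contraNneq nHP => /val_inj->.
rewrite (bigD1 (gval P)) ?S0 ?nPH ?andbT //= eqxx.
rewrite big1 => [|A /andP[_ /negPf->] //].
by rewrite addr0 => /(canRL (addrK _)); rewrite subrr.
Qed.

(** Let [P] act by conjugation on the other Sylow subgroups. The stabiliser of
    [Q] is [P :&: Q], because a p-subgroup of [G] normalising [Q] lies in [Q]. *)
Lemma card_Syl_mod G (m : nat) :
    {in 'Syl_p(G) &, forall P Q, P != Q -> m %| #|P : P :&: Q|} ->
  #|'Syl_p(G)| = 1 %[mod m].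
Proof.
move=> dvm; have [P sylP] := Sylow_exists p G.
have SylP : P \in 'Syl_p(G) by rewrite inE.
have actsP : [acts P, on 'Syl_p(G) :\ P | 'JG].
  have sPG := pHall_sub sylP.
  apply/subsetP=> x Px; rewrite !inE; apply/subsetP=> Q; rewrite !inE.
  case/andP=> nQP sylQ; apply/andP; split.
    apply: contra nQP => /eqP/(congr1 val)/= eqQx; apply/eqP/val_inj=> /=.
    by apply: (act_inj 'Js x); rewrite /= eqQx conjGid.
  by rewrite /= pHallJ ?(subsetP sPG).
rewrite (cardsD1 P) SylP.
suff /eqP dv : m %| #|'Syl_p(G) :\ P| by rewrite -modnDmr dv.
rewrite -(acts_sum_card_orbit actsP).
apply: dvdn_sum => _ /imsetP[Q /setD1P[nQP SylQ] ->].
rewrite card_orbit astab1JG.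
suff -> : 'N_P(Q) = P :&: Q by apply: dvm => //; rewrite eq_sym.
apply/eqP; rewrite eqEsubset subsetI subsetIl (setIS P (normG Q)) andbT /=.
rewrite inE in SylQ.
apply: norm_sub_max_pgroup (Hall_max SylQ) _ _ (subsetIr _ _).
  exact: pgroupS (subsetIl _ _) (pHall_pgroup sylP).
exact: subset_trans (subsetIl _ _) (pHall_sub sylP).
Qed.

(** The indices are powers of [p], for which the least one divides the others. *)
Lemma exists_min_Syl_index G : prime p -> ~~ p_closed p G ->
  exists2 d, is_min_Syl_index p G (p ^ d)
    & {in 'Syl_p(G) &, forall P Q, P != Q -> p ^ d %| #|P : P :&: Q|}.
Proof.
move=> p_pr nclG; have [P sylP] := Sylow_exists p G.
have [Q sylQ nPQ] : exists2 Q : {group gT}, p.-Sylow(G) Q & P != Q.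
  apply/exists_inP; apply: contraR nclG => /exists_inPn uniqP.
  apply/exists_inP; exists P; first by rewrite inE.
  rewrite /normal (pHall_sub sylP); apply/subsetP=> x Gx; rewrite inE.
  have /uniqP : p.-Sylow(G) (P :^ x)%G by rewrite pHallJ.
  by rewrite negbK => /eqP{2}->.
pose distinct (PQ : {group gT} * {group gT}) :=
  [&& PQ.1 \in 'Syl_p(G), PQ.2 \in 'Syl_p(G) & PQ.1 != PQ.2].
have dPQ : distinct (P, Q) by rewrite /distinct !inE sylP sylQ.
pose idx (PQ : {group gT} * {group gT}) := #|PQ.1 : PQ.1 :&: PQ.2|.
case: (arg_minnP idx dPQ) => -[P0 Q0].
case/and3P=> /= SylP0 SylQ0 nPQ0 min0.
have idxP (R S : {group gT}) : R \in 'Syl_p(G) ->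
    exists e, #|R : R :&: S| = (p ^ e)%N.
  rewrite inE => /pHall_pgroup pR.
  have [e ->] := p_natP (pnat_dvd (dvdn_indexg R (R :&: S)) pR).
  by exists e.
have [d defd] := idxP P0 Q0 SylP0; exists d => [|R S SylR SylS nRS].
  split; first by exists P0, Q0.
  by move=> R S SylR SylS nRS; rewrite -defd (min0 (R, S)) // /distinct SylR SylS.
have := min0 (R, S); rewrite /distinct /idx /= SylR SylS nRS => /(_ isT).
rewrite defd; have [e ->] := idxP R S SylR.
rewrite leq_exp2l ?prime_gt1 //; exact: dvdn_exp2l.
Qed.

(** If two Sylow subgroups [P] and [Q] contain [H], the multiplicity
    [#|P : H|] is a multiple of [#|P : P :&: Q|]; otherwise the value of [f H]
    is known exactly. *)
Lemma coweight_term_mod G m f H : coweight (psubgroups G) f -> psubgroup p G H ->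
    {in 'Syl_p(G) &, forall P Q, P != Q -> m %| #|P : P :&: Q|} ->
  ((f H *+ (#|G|`_p %/ #|H|))%R = (p.-Sylow(G) H)%:R%R %[mod m%:Z])%Z.
Proof.
move=> cwf pH dvm; have [sHG pgH] := andP pH.
have [P sylP sHP] := Sylow_superset sHG pgH.
have [/exists_inP[Q /andP[sylQ sHQ] nQP]|/exists_inPn uniqP] :=
    boolP [exists Q in [pred Q : {group gT} | p.-Sylow(G) Q && (H \subset Q)],
             Q != P].
  have dvHm : m %| #|G|`_p %/ #|H|.
    rewrite -(card_Hall sylP) divgS //.
    apply: dvdn_trans (dvm P Q _ _ _) _; rewrite ?inE // 1?eq_sym //.
    by apply: indexgS; rewrite subsetI sHP.
  have -> : p.-Sylow(G) H = false.
    apply/negP=> sylH; case/eqP: nQP; apply/val_inj/eqP => /=.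
    have eqH (R : {group gT}) : p.-Sylow(G) R -> H \subset R -> R = H :> {set gT}.
      move=> sylR sHR; apply/eqP; rewrite eq_sym eqEcard sHR.
      by rewrite (card_Hall sylR) (card_Hall sylH) leqnn.
    by rewrite (eqH Q) // (eqH P).
  apply/eqP; rewrite eqz_mod_dvd subr0 -mulr_natr natz.
  exact: dvdz_mull.
have fH := coweight_unique_Sylow cwf sylP pH.
rewrite fH => [|Q sylQ sHQ]; last first.
  by apply/eqP; rewrite -[_ == _]negbK uniqP // inE sylQ.
have [->|nHP] := eqVneq H P.
  by rewrite sylP -(card_Hall sylP) divnn cardG_gt0.
rewrite mul0rn; case: (boolP (p.-Sylow(G) H)) => // sylH; case/eqP: nHP.
by apply/val_inj/eqP; rewrite /= eqEcard sHP (card_Hall sylP) (card_Hall sylH) /=.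
Qed.

Lemma chi_p_mod G (m : nat) :
    {in 'Syl_p(G) &, forall P Q, P != Q -> m %| #|P : P :&: Q|} ->
  (chi_p p G = 1 %[mod m%:Z])%Z.
Proof.
move=> dvm; have [f cwf] := coweight_exists (psubgroups G).
(* Both sides are sums over the p-subgroups of [G]; compare them termwise. *)
have n_pE : (#|'Syl_p(G)|%:Z
    = \sum_(H : {group gT} | psubgroup p G H) (p.-Sylow(G) H)%:R)%R.
  rewrite -sum1_card -natz natr_sum [RHS]big_mkcond [LHS]big_mkcond.
  apply: eq_bigr => H _; rewrite inE; case sylH: (p.-Sylow(G) H); last by case: ifP.
  rewrite ifT //.
  by apply/andP; split; [apply: pHall_sub sylH | apply: pHall_pgroup sylH].
transitivity (#|'Syl_p(G)|%:Z %% m%:Z)%Z; last first.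
  by rewrite !modz_nat (card_Syl_mod dvm).
apply/eqP; rewrite eqz_mod_dvd (chi_pE cwf) n_pE -sumrB.
apply: rpred_sum => H pH; rewrite -eqz_mod_dvd; apply/eqP.
exact: coweight_term_mod.
Qed.

End CosetPoset.

Theorem theorem4 (p : nat) (hp : prime p) (gT : finGroupType)
    (G : {group gT}) (hG : ~~ p_closed p G) :
  exists d : nat,
    is_min_Syl_index p G (p ^ d)%N /\
    (chi_p p G = 1 %[mod (p ^ d)%N%:Z])%Z.
Proof.
have [d min_d dvd_d] := exists_min_Syl_index hp hG.
by exists d; split; last exact: chi_p_mod.
Qed.
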